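(* Let $K\ge 2$. When $\beta=1$ and $f$ is the proportional selection rule, the Singleton Search Engine Game with $K$ engines has a unique pure Nash equilibrium; in this equilibrium, each engine selects each page $n\in\{1,\dots,N\}$ with probability $\gamma(n)$.
   Context: Proportional selection rule: $f_i(\mathbf q)=\frac{q_i}{\sum_j q_j}$ for $\mathbf q\in[0,1]^K\setminus\{\mathbf 0\}$, and $f_i(\mathbf 0)=1/K$. Singleton Search Engine Game: there are $K$ engines, $N$ pages $\{1,\dots,N\}$, and a probability distribution $\gamma$ on pages with $\gamma(n)>0$ for all $n$; a user of type $n$ (probability $\gamma(n)$) desires exactly page $n$ and looks only at the first displayed page. A pure strategy of engine $i$ is a probability vector $\mathbf q_i=(q_i(n))_{n=1}^N$, where $q_i(n)$ is the probability of displaying (selecting) page $n$. With $\mathbf q(n)=(q_1(n),\dots,q_K(n))$ and parameter $\beta\in[0,1]$, engine $i$'s payoff is $\sum_n\gamma(n)f_i(\mathbf q(n))(\beta+(1-\beta)q_i(n))$, where $f_i(\mathbf q(n))$ is the probability that a user of type $n$ selects engine $i$; for $\beta=1$ the payoff is $\sum_n\gamma(n)f_i(\mathbf q(n))$. A pure Nash equilibrium is a profile of pure strategies from which no engine can strictly improve her payoff by a unilateral deviation to another pure strategy. *)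

(* Defs.v *)
From mathcomp Require Import all_boot all_order all_algebra.
From mathcomp Require Import reals.

Set Implicit Arguments.
Unset Strict Implicit.
Unset Printing Implicit Defensive.

Import Order.TTheory GRing.Theory Num.Theory.
Local Open Scope ring_scope.

(* Pages are indexed by 'I_N and engines by 'I_K, i.e. numbered from 0. *)

Definition prob_vector (R : realType) (N : nat) (p : {ffun 'I_N -> R}) : Prop :=
  (forall n, 0 <= p n) /\ \sum_n p n = 1.

(* [f i q] is the probability that a user selects engine [i] when engine [j]
   displays the page the user wants with probability [q j]. *)
Definition selection_rule (R : realType) (K : nat) : Type :=
  'I_K -> {ffun 'I_K -> R} -> R.

(* Only values in the cube [0,1]^K matter, where the denominator is positive
   in the second branch. *)
Definition proportional (R : realType) (K : nat) : selection_rule R K :=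
  fun i q => if [forall j, q j == 0] then K%:R^-1 else q i / \sum_j q j.

(* A profile [q] gives the probability [q i n] that engine [i] displays
   page [n]. *)
Definition profile (R : realType) (K N : nat) : Type :=
  {ffun 'I_K -> {ffun 'I_N -> R}}.

Definition page_slice (R : realType) (K N : nat) (q : profile R K N)
    (n : 'I_N) : {ffun 'I_K -> R} :=
  [ffun i => q i n].

Definition payoff (R : realType) (K N : nat) (f : selection_rule R K)
    (beta : R) (gamma : {ffun 'I_N -> R}) (q : profile R K N) (i : 'I_K) : R :=
  \sum_n gamma n * f i (page_slice q n) * (beta + (1 - beta) * q i n).

Definition deviate (R : realType) (K N : nat) (q : profile R K N)
    (i : 'I_K) (s : {ffun 'I_N -> R}) : profile R K N :=
  [ffun j => if j == i then s else q j].

Definition pure_nash (R : realType) (K N : nat) (f : selection_rule R K)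
    (beta : R) (gamma : {ffun 'I_N -> R}) (q : profile R K N) : Prop :=
  (forall i, prob_vector (q i)) /\
  (forall i s, prob_vector s ->
     payoff f beta gamma (deviate q i s) i <= payoff f beta gamma q i).

(* Main.v *)
Require Import Defs.
From mathcomp Require Import all_boot all_order all_algebra.
From mathcomp Require Import reals.
From mathcomp Require Import ring lra.

Set Implicit Arguments.
Unset Strict Implicit.
Unset Printing Implicit Defensive.

Import Order.TTheory GRing.Theory Num.Theory.
Local Open Scope ring_scope.

(** Write [S n] for the total probability that the engines put on page [n],
    [r i n = q i n / S n] for the share of engine [i] on that page, and
    [t n = S n / gamma n]. Moving a small amount of probability from page [m]
    to page [n] cannot help in equilibrium: first, every [S n] is positive, as
    otherwise an arbitrarily small probability would capture page [n]; second,
    [(1 - r i n) / t n <= (1 - r i m) / t m] whenever [q i m > 0]. If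
    [t n < t m], then [r i n >= r i m] for all [i], strictly as soon as
    [0 < r i m < 1], although both families of shares sum to 1; so [t] is
    constant. Then [r i] is constant too, and normalization leaves
    [q i n = gamma n]. Conversely, the profile where everybody plays [gamma] is
    an equilibrium because [x / (x + c)] lies below its tangent lines. *)

(** Stands in for the limit [e -> 0]: with denominators cleared, the inequalities for small
    deviations take the form [a <= b * e]. *)
Lemma le0_of_le_small (R : realType) (a b d : R) :
  0 < d -> (forall e, 0 < e -> e < d -> a <= b * e) -> a <= 0.
Proof.
move=> d0 H; rewrite leNgt; apply/negP => a0.
have b0 : 0 < b.
  have := H (d / 2) ltac:(lra) ltac:(lra) => h.
  have : 0 < b * (d / 2) by lra.
  by rewrite pmulr_lgt0 //; lra.
(* This [e] is admissible and gives [b * e <= a / 2 < a]. *)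
pose e := Num.min (d / 2) (a / (2 * b)).
have e0 : 0 < e by rewrite lt_min !divr_gt0 ?mulr_gt0.
have ed : e < d by rewrite gt_min; apply/orP; left; lra.
have : b * e <= b * (a / (2 * b)) by rewrite ler_pM2l // ge_min lexx orbT.
have -> : b * (a / (2 * b)) = a / 2 by field; rewrite gt_eqF.
have := H e e0 ed; lra.
Qed.

(** Concavity in [x] made explicit: the gap is a nonnegative multiple of [(x - y) ^+ 2]. *)
Lemma share_le_tangent (R : realType) (x y c : R) :
  0 <= x -> 0 < y -> 0 <= c ->
  0 < x + c -> x / (x + c) <= y / (y + c) + c / (y + c) ^+ 2 * (x - y).
Proof.
move=> x0 y0 c0 xc0; have yc0 : 0 < y + c by lra.
rewrite -subr_ge0.
have -> : y / (y + c) + c / (y + c) ^+ 2 * (x - y) - x / (x + c) =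
   c * (x - y) ^+ 2 / ((y + c) ^+ 2 * (x + c)).
  by field; rewrite !gt_eqF //.
by apply: divr_ge0; apply: mulr_ge0; rewrite ?sqr_ge0 // ltW.
Qed.

Lemma prob_vector_gt0 (R : realType) (N : nat) (p : {ffun 'I_N -> R}) :
  prob_vector p -> exists n, 0 < p n.
Proof.
move=> [p0 p1]; case: (boolP [exists n, 0 < p n]) => [/existsP //|].
rewrite negb_exists => /forallP H.
have : \sum_n p n = 0.
  by apply: big1 => n _; apply/eqP; rewrite eq_le p0 andbT leNgt H.
by rewrite p1 => /eqP; rewrite oner_eq0.
Qed.

(** * Page masses and the proportional rule *)

Definition mass (R : realType) (K N : nat) (q : profile R K N) (n : 'I_N) : R :=
  \sum_j q j n.

Lemma mass_deviate (R : realType) (K N : nat) (q : profile R K N) i s n :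
  mass (deviate q i s) n = mass q n - q i n + s n.
Proof.
rewrite /mass (bigD1 i) //= (bigD1 (F := fun j => q j n) i) //= ffunE eqxx.
rewrite (eq_bigr (fun j => q j n)) => [|j /negbTE ji]; last by rewrite ffunE ji.
ring.
Qed.

Lemma proportional_mass (R : realType) (K N : nat) (q : profile R K N) i n :
  mass q n != 0 -> proportional i (page_slice q n) = q i n / mass q n.
Proof.
move=> S0; rewrite /proportional.
have sumE : \sum_j page_slice q n j = mass q n.
  by apply: eq_bigr => j _; rewrite ffunE.
case: ifP => [/forallP H|_]; last by rewrite sumE ffunE.
by move: S0; rewrite -sumE big1 ?eqxx // => j _; apply/eqP.
Qed.

Lemma proportional_unserved (R : realType) (K N : nat) (q : profile R K N) i n :
  (forall j, q j n = 0) -> proportional i (page_slice q n) = K%:R^-1.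
Proof.
by move=> H; rewrite /proportional ifT //; apply/forallP => j; rewrite ffunE H.
Qed.

Lemma payoff_beta1 (R : realType) (K N : nat) (f : selection_rule R K)
    (gamma : {ffun 'I_N -> R}) (q : profile R K N) i :
  payoff f 1 gamma q i = \sum_n gamma n * f i (page_slice q n).
Proof. by apply: eq_bigr => n _; rewrite subrr mul0r addr0 mulr1. Qed.

(** * Moving probability between two pages *)

Definition shift (R : realType) (N : nat) (p : {ffun 'I_N -> R}) (m n : 'I_N)
    (e : R) : {ffun 'I_N -> R} :=
  [ffun k => p k + (if k == n then e else 0) - (if k == m then e else 0)].

Lemma prob_vector_shift (R : realType) (N : nat) (p : {ffun 'I_N -> R}) m n e :
  prob_vector p -> 0 < e -> e < p m -> prob_vector (shift p m n e).
Proof.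
move=> [p0 p1] e0 em; split=> [k|].
  rewrite ffunE; have := p0 k.
  by case: (eqVneq k m) => [->|_]; case: eqVneq => _; lra.
under eq_bigr do rewrite ffunE.
rewrite sumrB big_split /= p1 -!big_mkcond /= !big_pred1_eq; lra.
Qed.

Lemma page_slice_deviate_id (R : realType) (K N : nat) (q : profile R K N)
    i (s : {ffun 'I_N -> R}) k :
  s k = q i k -> page_slice (deviate q i s) k = page_slice q k.
Proof.
by move=> sk; apply/ffunP => j; rewrite !ffunE; case: eqVneq => [->|].
Qed.

(** The terms of all pages other than [m] and [n] cancel. Since [e < q i m] is strict, page [m]
    stays served after the shift. *)
Lemma pure_nash_shift (R : realType) (K N : nat) (f : selection_rule R K)
    (gamma : {ffun 'I_N -> R}) (q : profile R K N) i m n e :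
  pure_nash f 1 gamma q -> m != n -> 0 < e -> e < q i m ->
  gamma n * f i (page_slice (deviate q i (shift (q i) m n e)) n) +
  gamma m * f i (page_slice (deviate q i (shift (q i) m n e)) m) <=
  gamma n * f i (page_slice q n) + gamma m * f i (page_slice q m).
Proof.
move=> [qp qN] mn e0 em.
have := qN i _ (prob_vector_shift n (qp i) e0 em).
rewrite !payoff_beta1.
rewrite (bigD1 n) //= (bigD1 m) //= [leRHS](bigD1 n) //=.
rewrite [X in _ <= _ + X](bigD1 m) //= !addrA.
set X := \sum_(_ < _ | _) _; set Y := \sum_(_ < _ | _) _.
have -> : X = Y; last by rewrite lerD2r.
apply: eq_bigr => k /andP[/negbTE kn /negbTE km]; rewrite page_slice_deviate_id //.
by rewrite ffunE kn km; ring.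
Qed.

(** * Existence: everybody plays [gamma] *)

Section Equilibrium.
Variables (R : realType) (K N : nat) (gamma : {ffun 'I_N -> R}).
Hypothesis K_ge2 : (2 <= K)%N.
Hypothesis gamma_prob : prob_vector gamma.
Hypothesis gamma_gt0 : forall n, 0 < gamma n.

Let K_gt1 : 1 < K%:R :> R. Proof. by rewrite ltr1n. Qed.
Let K_gt0 : 0 < K%:R :> R. Proof. exact: lt_trans K_gt1. Qed.

Lemma pure_nash_cst : pure_nash (@proportional R K) 1 gamma [ffun=> gamma].
Proof.
set q : profile R K N := [ffun=> gamma].
have massE n : mass q n = K%:R * gamma n.
  rewrite /mass (eq_bigr (fun=> gamma n)) => [|j _]; last by rewrite ffunE.
  by rewrite sumr_const card_ord mulr_natl.
split=> [i|i s [s0 s1]]; first by rewrite ffunE.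
rewrite !payoff_beta1.
have [_ g1] := gamma_prob.
(* [gamma n] times the tangent slope at [gamma n] with [c = (K - 1) * gamma n]. It does not depend
   on [n], so the linear terms sum to 0. *)
pose b : R := (K%:R - 1) / K%:R ^+ 2.
have -> : \sum_n gamma n * proportional i (page_slice q n) =
          \sum_n (gamma n / K%:R + b * (s n - gamma n)).
  rewrite big_split /= -mulr_sumr sumrB s1 g1 subrr mulr0 addr0.
  apply: eq_bigr => n _; have g0 := gamma_gt0 n.
  rewrite proportional_mass massE ?ffunE ?mulf_neq0 ?gt_eqF //.
  by field; rewrite !gt_eqF.
apply: ler_sum => n _; have g0 := gamma_gt0 n.
have c0 : 0 < (K%:R - 1) * gamma n by rewrite mulr_gt0 // subr_gt0.
have dE : mass (deviate q i s) n = s n + (K%:R - 1) * gamma n.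
  by rewrite mass_deviate massE ffunE; ring.
have d0 : 0 < s n + (K%:R - 1) * gamma n by have := s0 n; lra.
rewrite proportional_mass dE ?gt_eqF // ffunE eqxx.
have := share_le_tangent (s0 n) g0 (ltW c0) d0.
rewrite -(ler_pM2l g0 (s n / _)) => /le_trans; apply.
rewrite le_eqVlt; apply/orP; left; apply/eqP; rewrite /b.
by field; rewrite !gt_eqF //; lra.
Qed.

(** * Uniqueness: first-order conditions *)

Variable q : profile R K N.
Hypothesis q_nash : pure_nash (@proportional R K) 1 gamma q.

Let q_ge0 i n : 0 <= q i n. Proof. by have [/(_ i)[]] := q_nash. Qed.
Let q_sum1 i : \sum_n q i n = 1. Proof. by have [/(_ i)[]] := q_nash. Qed.

Lemma le_mass i n : q i n <= mass q n.
Proof. by rewrite /mass (bigD1 i) //= lerDl sumr_ge0. Qed.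

(** The last term is the exact loss on page [m]. The old share on page [n] stays unevaluated, so
    that an unserved [n] is covered too. *)
Let shift_gain i m n e : m != n -> 0 < e -> e < q i m ->
  gamma n * ((q i n + e) / (mass q n + e)) <=
  gamma n * proportional i (page_slice q n) +
  gamma m * ((mass q m - q i m) * e / (mass q m * (mass q m - e))).
Proof.
move=> mn e0 em; have nm : n != m by rewrite eq_sym.
have qS := le_mass i m; have qSn := le_mass i n; have qn := q_ge0 i n.
have := pure_nash_shift q_nash mn e0 em.
have mE : mass (deviate q i (shift (q i) m n e)) m = mass q m - e.
  by rewrite mass_deviate ffunE eqxx (negbTE mn); ring.
have nE : mass (deviate q i (shift (q i) m n e)) n = mass q n + e.
  by rewrite mass_deviate ffunE eqxx (negbTE nm); ring.
rewrite proportional_mass nE ?gt_eqF //; last lra.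
rewrite proportional_mass mE ?gt_eqF //; last lra.
rewrite [in X in _ <= _ + X]proportional_mass ?gt_eqF //; last lra.
rewrite !ffunE eqxx !ffunE !eqxx (negbTE mn) (negbTE nm).
rewrite subr0 addr0 -lerBrDr -addrA -mulrBr => /le_trans; apply.
rewrite lerD2l le_eqVlt; apply/orP; left; apply/eqP.
by field; rewrite !gt_eqF //; lra.
Qed.

Lemma mass_gt0 n : 0 < mass q n.
Proof.
rewrite lt_def sumr_ge0 // andbT; apply/negP => /eqP S0.
have qn0 j : q j n = 0.
  by apply/eqP; rewrite eq_le q_ge0 andbT -S0 le_mass.
pose i := Ordinal (ltnW K_ge2).
have [m qm] : exists m, 0 < q i m by apply: prob_vector_gt0; case: q_nash.
have mn : m != n by apply: contraTneq qm => ->; rewrite qn0 ltxx.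
have qS := le_mass i m.
have Kinv : 0 < 1 - K%:R^-1 :> R by rewrite subr_gt0 invf_lt1.
have g0 := gamma_gt0 n.
(* Any [e > 0] lifts the share on page [n] from the default [1 / K] to 1, at a cost on [m] of order
   [e]. The factor [mass q m ^+ 2] comes from clearing the denominator of that cost. *)
suff : gamma n * (1 - K%:R^-1) * mass q m ^+ 2 <= 0.
  by rewrite leNgt !mulr_gt0 ?exprn_gt0 //; lra.
apply: (@le0_of_le_small _ _ (gamma m * (mass q m - q i m) +
   gamma n * (1 - K%:R^-1) * mass q m) (q i m)) => // e e0 em.
have := shift_gain mn e0 em.
rewrite proportional_unserved // qn0 S0 !add0r divff ?gt_eqF // mulr1.
rewrite -lerBlDl -{1}[gamma n]mulr1 -mulrBr mulrA ler_pdivlMr; last first.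
  by rewrite mulr_gt0; lra.
by lra.
Qed.

(** The marginal value of page [n] to engine [i] is [gamma n * (mass q n - q i n) / mass q n ^+ 2];
    it cannot exceed that of a page [m] from which [i] can withdraw probability. *)
Lemma pure_nash_foc i m n : 0 < q i m ->
  gamma n * (mass q n - q i n) * mass q m ^+ 2 <=
  gamma m * (mass q m - q i m) * mass q n ^+ 2.
Proof.
move=> qm; have [->//|mn] := eqVneq m n.
have Sm := mass_gt0 m; have Sn := mass_gt0 n.
rewrite -subr_le0.
apply: (@le0_of_le_small _ _ (gamma m * (mass q m - q i m) * mass q n +
   gamma n * (mass q n - q i n) * mass q m) (q i m)) => // e e0 em.
have qS := le_mass i m.
have := shift_gain mn e0 em.
rewrite proportional_mass ?gt_eqF // -lerBlDl -mulrBr.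
have -> : (q i n + e) / (mass q n + e) - q i n / mass q n =
  (mass q n - q i n) * e / (mass q n * (mass q n + e)).
  by field; rewrite !gt_eqF //; lra.
rewrite !mulrA ler_pdivlMr; last by rewrite mulr_gt0; lra.
rewrite mulrAC ler_pdivrMr; last by rewrite mulr_gt0; lra.
set A := gamma n * _; set B := gamma m * _ => h.
have : A * (mass q m * (mass q m - e)) <= B * (mass q n * (mass q n + e)).
  by rewrite -(ler_pM2r e0); lra.
lra.
Qed.

(** * Uniqueness: the shares [r] and the ratios [t] *)

Definition share i n : R := q i n / mass q n.
Definition load n : R := mass q n / gamma n.

Lemma load_gt0 n : 0 < load n.
Proof. by rewrite divr_gt0 ?mass_gt0. Qed.

Lemma sum_share n : \sum_i share i n = 1.
Proof. by rewrite -mulr_suml divff // gt_eqF ?mass_gt0. Qed.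

Lemma share_gt0 i n : (0 < share i n) = (0 < q i n).
Proof. by rewrite pmulr_lgt0 // invr_gt0 mass_gt0. Qed.

Lemma share_ge0 i n : 0 <= share i n.
Proof. by rewrite divr_ge0 // ltW ?mass_gt0. Qed.

Lemma share_le1 i n : share i n <= 1.
Proof. by rewrite ler_pdivrMr ?mass_gt0 // mul1r le_mass. Qed.

Lemma share_foc i m n : 0 < share i m ->
  (1 - share i n) * load m <= (1 - share i m) * load n.
Proof.
rewrite share_gt0 => qm; have := pure_nash_foc n qm.
have Sm := mass_gt0 m; have Sn := mass_gt0 n.
have gm := gamma_gt0 m; have gn := gamma_gt0 n.
(* Scaling by [c] turns both sides into those of [pure_nash_foc]. *)
pose c := mass q n * mass q m * gamma n * gamma m.
have c0 : 0 < c by rewrite !mulr_gt0.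
rewrite -(ler_pM2r c0 (_ * load m)).
have -> : (1 - share i n) * load m * c =
    gamma n * (mass q n - q i n) * mass q m ^+ 2.
  by rewrite /c /share /load; field; rewrite !gt_eqF.
suff -> : (1 - share i m) * load n * c =
    gamma m * (mass q m - q i m) * mass q n ^+ 2 by [].
by rewrite /c /share /load; field; rewrite !gt_eqF.
Qed.

(** A sole owner of page [m] loses nothing to first order by withdrawing from it, so [share_foc]
    makes it sole owner of every page. This leaves no page for a second engine. *)
Lemma share_lt1 i m : share i m < 1.
Proof.
rewrite lt_neqAle share_le1 andbT; apply/negP => /eqP s1.
have all1 n : share i n = 1.
  have s0 : 0 < share i m by rewrite s1.
  have := share_foc n s0; rewrite s1 subrr mul0r pmulr_lle0 ?load_gt0 //.
  by have := share_le1 i n; lra.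
have [j ji] : exists j : 'I_K, j != i.
  case: (eqVneq i (Ordinal (ltnW K_ge2))) => [->|ni].
    by exists (Ordinal K_ge2).
  by exists (Ordinal (ltnW K_ge2)); rewrite eq_sym.
have [n qn] : exists n, 0 < q j n by apply: prob_vector_gt0; case: q_nash.
have := sum_share n; rewrite (bigD1 i) //= (bigD1 j) //= all1.
have : 0 < share j n by rewrite share_gt0.
have : 0 <= \sum_(k < K | (k != i) && (k != j)) share k n.
  by apply: sumr_ge0 => k _; apply: share_ge0.
lra.
Qed.

Lemma load_le n m : load m <= load n.
Proof.
rewrite leNgt; apply/negP => tnm.
have tm := load_gt0 m.
have lt_share i : 0 < share i m -> share i m < share i n.
  move=> /(share_foc n) h; have s1 := share_lt1 i m.
  have : (1 - share i m) * load n < (1 - share i m) * load m.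
    by rewrite ltr_pM2l // subr_gt0.
  move=> /(le_lt_trans h); rewrite ltr_pM2r //; lra.
have le_share i : share i m <= share i n.
  have [/lt_share/ltW//|] := ltP 0 (share i m).
  by move=> /le_trans; apply; apply: share_ge0.
(* Termwise domination between families with equal sums is equality. *)
have eq_share i : share i m = share i n.
  have : \sum_i (share i n - share i m) = 0 by rewrite sumrB !sum_share subrr.
  move=> /psumr_eq0P/(_ i isT) H; apply/esym/eqP; rewrite -subr_eq0; apply/eqP.
  by apply: H => j _; rewrite subr_ge0.
(* By [lt_share], equality forces every share on [m] to vanish, yet they sum to 1. *)
have := sum_share m; rewrite big1 => [/esym/eqP|i _]; first by rewrite oner_eq0.
apply/eqP; rewrite eq_le share_ge0 andbT leNgt; apply/negP => /lt_share.
by rewrite eq_share ltxx.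
Qed.

Lemma share_cst i n m : share i m = share i n.
Proof.
suff le_share k l : share i k <= share i l by apply: le_anti; rewrite !le_share.
have [s0|/le_trans->//] := ltP 0 (share i k); last exact: share_ge0.
have tE : load k = load l by apply: le_anti; rewrite !load_le.
have := share_foc l s0; rewrite tE ler_pM2r ?load_gt0 //; lra.
Qed.

Lemma pure_nash_eq i n : q i n = gamma n.
Proof.
(* [q i] is a constant multiple of [gamma]; as both sum to 1, the constant is 1. *)
have qE k : q i k = share i n * load n * gamma k.
  have -> : load n = load k by apply: le_anti; rewrite !load_le.
  rewrite (share_cst i k n) /share /load; field.
  by rewrite !gt_eqF ?mass_gt0.
have : \sum_k q i k = share i n * load n.
  under eq_bigr do rewrite qE.
  by rewrite -mulr_sumr; have [_ ->] := gamma_prob; rewrite mulr1.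
by rewrite q_sum1 qE => <-; rewrite mul1r.
Qed.

End Equilibrium.

Theorem theorem4p2 (R : realType) (K N : nat) (gamma : {ffun 'I_N -> R})
    (hK : (2 <= K)%N) (gamma_prob : prob_vector gamma)
    (gamma_gt0 : forall n, 0 < gamma n) :
  (exists! q : profile R K N, pure_nash (@proportional R K) 1 gamma q) /\
  (forall q : profile R K N, pure_nash (@proportional R K) 1 gamma q ->
     forall (i : 'I_K) (n : 'I_N), q i n = gamma n).
Proof.
split; last by move=> q q_nash i n; apply: pure_nash_eq.
exists [ffun=> gamma]; split; first exact: pure_nash_cst.
move=> q q_nash; apply/ffunP => i; apply/ffunP => n; rewrite ffunE.
by apply/esym/pure_nash_eq.
Qed.
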